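(* Let $p$ be a prime, $q=p^\lambda$ with $\lambda\ge1$, and let $F$ be a field with $\mathbb F_q\subseteq F$. Then $\mathfrak{BD}^\ast_{q,0}\subseteq\mathfrak{BD}^\ast$ is an $\mathbb F_p$-subspace of $\mathfrak{BD}^\ast$.
   Context: $F[x]\{\{\mathfrak D\}\}$ is the commutative ring of formal series $\sum_{i\ge0}a_i\mathfrak D_i$ ($a_i\in F[x]$) with coefficientwise addition and multiplication $(\sum_i a_i\mathfrak D_i)(\sum_j b_j\mathfrak D_j)=\sum_n\big(\sum_{i=0}^n\binom ni a_ib_{n-i}\big)\mathfrak D_n$; its unit is $\mathfrak D_0=1$. A sequence $P=\{p_i(x)\}_{i=0}^\infty$ in $F[x]$ satisfies the Binomial Theorem if $p_n(x+y)=\sum_{i=0}^n \binom{n}{i}p_i(x)p_{n-i}(y)$ for all $n\ge 0$; it is nontrivial if not all $p_i(x)$ are zero. Its generating function is $f_P(x)=\sum_{i\ge0}p_i(x)\mathfrak D_i$. $\mathfrak{BD}^\ast$ is the set of generating functions of nontrivial sequences satisfying the Binomial Theorem; it is an abelian group under multiplication in which every element satisfies $f^p=1$, and it is thus regarded as an $\mathbb F_p$-vector space, with vector addition being multiplication of series and scalar multiplication $(n\bmod p)\cdot f=f^n$. A polynomial in $F[x]$ is $\mathbb F_q$-linear if it is a finite $F$-linear combination of monomials $x^{q^n}$, $n\ge0$; $\mathfrak L_q$ is the set of sequences $E=\{e_t(x)\}_{t=0}^\infty$ of $\mathbb F_q$-linear polynomials. For $E\in\mathfrak L_q$ and $i=\sum_t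 i_tq^t$ ($0\le i_t<q$) put $p_{E,i}(x):=\prod_t e_t(x)^{i_t}$ (with $e^0=1$) and $P_E:=\{p_{E,i}(x)\}_{i=0}^\infty$. Then $\mathfrak{BD}^\ast_{q,0}:=\{f_{P_E}(x):E\in\mathfrak L_q\}$. *)

(* Defs.v *)
(* MathComp; mathcomp.classical supplies Prop-valued sets, and equality
   and choice on the (infinite) coefficient sequences. *)
From HB Require Import structures.
From mathcomp Require Import all_boot all_algebra all_field.
From mathcomp Require Import boolp classical_sets.

Set Implicit Arguments.
Unset Strict Implicit.
Unset Printing Implicit Defensive.

Import GRing.Theory.
Local Open Scope classical_set_scope.
Local Open Scope ring_scope.

(* [DivSeries a] is the formal series \sum_i a_i D_i, where D_i behaves as a
   divided power: D_i D_j = 'C(i + j, i) D_(i + j). *)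
Record divseries (R : Type) := DivSeries { dcoef :> nat -> R }.

Lemma divseriesP R (f g : divseries R) : f =1 g -> f = g.
Proof. by case: f g => [f] [g] /= /funext ->. Qed.

HB.instance Definition _ (R : Type) := gen_eqMixin (divseries R).
HB.instance Definition _ (R : Type) := gen_choiceMixin (divseries R).

Section DivSeriesZmod.
Variable R : zmodType.
Implicit Types f g h : divseries R.

Definition dadd f g : divseries R := DivSeries (fun n => f n + g n).
Definition dopp f : divseries R := DivSeries (fun n => - f n).
Definition dzero : divseries R := DivSeries (fun=> 0).

Fact daddA : associative dadd.
Proof. by move=> f g h; apply: divseriesP => n /=; rewrite addrA. Qed.
Fact daddC : commutative dadd.
Proof. by move=> f g; apply: divseriesP => n /=; rewrite addrC. Qed.
Fact dadd0 : left_id dzero dadd.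
Proof. by move=> f; apply: divseriesP => n /=; rewrite add0r. Qed.
Fact daddN : left_inverse dzero dopp dadd.
Proof. by move=> f; apply: divseriesP => n /=; rewrite addNr. Qed.

HB.instance Definition _ :=
  GRing.isZmodule.Build (divseries R) daddA daddC dadd0 daddN.

Lemma dcoefD f g n : (f + g) n = f n + g n. Proof. by []. Qed.

Lemma dcoefMn f k n : (f *+ k) n = f n *+ k.
Proof. by elim: k => [|k IHk] //; rewrite !mulrS dcoefD IHk. Qed.

End DivSeriesZmod.

Section DivSeriesRing.
Variable R : comNzRingType.
Implicit Types f g h : divseries R.

Definition dmul f g : divseries R :=
  DivSeries (fun n => \sum_(i < n.+1) (f i * g (n - i)%N) *+ 'C(n, i)).
Definition dunit : divseries R := DivSeries (fun n => (n == 0%N)%:R).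

(* The derivation D_(i + 1) |-> D_i. *)
Definition dshift f : divseries R := DivSeries (fun n => f n.+1).

Lemma dmul_coef0 f g : dmul f g 0%N = f 0%N * g 0%N.
Proof. by rewrite /= big_ord1 bin0. Qed.

Lemma dshiftM f g : dshift (dmul f g) = dmul (dshift f) g + dmul f (dshift g).
Proof.
apply: divseriesP => n; rewrite dcoefD /= big_ord_recl bin0 subn0.
under [X in _ + X = _]eq_bigr => i _ do
  rewrite /= /bump leq0n add1n binS mulrnDr subSS.
rewrite big_split /= [LHS]addrA [LHS]addrC; congr (_ + _).
rewrite big_ord_recr /= bin_small // mulr0n addr0.
rewrite [RHS]big_ord_recl bin0 subn0; congr (_ + _).
by apply: eq_bigr => i _; rewrite /= /bump leq0n add1n subnSK.
Qed.

Fact dmulDl : left_distributive dmul +%R.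
Proof.
move=> f g h; apply: divseriesP => n; rewrite dcoefD /= -big_split.
by apply: eq_bigr => i _; rewrite mulrDl mulrnDl.
Qed.

Fact dmulC : commutative dmul.
Proof.
move=> f g; apply: divseriesP => n; elim: n => [|n IHn] in f g *.
  by rewrite !dmul_coef0 mulrC.
rewrite -![dmul _ _ n.+1]/(dshift (dmul _ _) n) !dshiftM !dcoefD.
by rewrite addrC IHn [X in _ + X]IHn.
Qed.

Fact dmulA : associative dmul.
Proof.
move=> f g h; apply: divseriesP => n; elim: n => [|n IHn] in f g h *.
  by rewrite !dmul_coef0 mulrA.
rewrite -![dmul _ _ n.+1]/(dshift (dmul _ _) n) !dshiftM dmulDl.
by rewrite (dmulC f (_ + _)) dmulDl !(dmulC _ f) !dcoefD !IHn addrA.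
Qed.

Fact dmul1 : left_id dunit dmul.
Proof.
move=> f; apply: divseriesP => n /=; rewrite big_ord_recl /= mul1r bin0 subn0.
by rewrite big1 ?addr0 // => i _; rewrite mul0r mul0rn.
Qed.

Fact dunit_neq0 : dunit != 0.
Proof.
apply/eqP => /(congr1 (fun f : divseries R => f 0%N)) /= /eqP.
by rewrite oner_eq0.
Qed.

HB.instance Definition _ := GRing.Zmodule_isComNzRing.Build (divseries R)
  dmulA dmulC dmul1 dmulDl dunit_neq0.

Lemma dcoefM f g n :
  (f * g) n = \sum_(i < n.+1) (f i * g (n - i)%N) *+ 'C(n, i).
Proof. by []. Qed.

Lemma dshift_mul f g : dshift (f * g) = dshift f * g + f * dshift g.
Proof. exact: dshiftM. Qed.

Lemma dcoefX0 f k : (f ^+ k) 0%N = f 0%N ^+ k.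
Proof.
by elim: k => [|k IHk] //; rewrite !exprS -IHk; apply: dmul_coef0.
Qed.

Lemma dshiftX f k : dshift (f ^+ k.+1) = (f ^+ k * dshift f) *+ k.+1.
Proof.
elim: k => [|k IHk]; first by rewrite mul1r.
by rewrite exprS dshift_mul IHk mulrnAr mulrA -exprS mulrC -mulrS.
Qed.

Lemma divseries_expp p f : p \in [pchar R] -> f 0%N = 1 -> f ^+ p = 1.
Proof.
move=> charRp f0; have p_gt0 := prime_gt0 (pcharf_prime charRp).
apply: divseriesP => -[|n]; first by rewrite dcoefX0 f0 expr1n.
rewrite -(prednK p_gt0) -[LHS]/(dshift (f ^+ _) n) dshiftX prednK //.
by rewrite dcoefMn (mulrn_pchar charRp).
Qed.

End DivSeriesRing.

Section DivSeriesMap.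
Variables R S : comNzRingType.

Definition dmap (phi : R -> S) (f : divseries R) : divseries S :=
  DivSeries (phi \o f).

Lemma dmapM (phi : {rmorphism R -> S}) f g :
  dmap phi (f * g) = dmap phi f * dmap phi g.
Proof.
apply: divseriesP => n; rewrite dcoefM /= rmorph_sum.
by apply: eq_bigr => i _; rewrite rmorphMn rmorphM.
Qed.

End DivSeriesMap.

Section BinomialTheorem.
Variable F : fieldType.
Implicit Types (P : nat -> {poly F}) (f : divseries {poly F}).

(* An identity between formal polynomials in two variables (F may be finite),
   as elements of {poly {poly F}}: [poly_XaY u], [u^:P] and [u%:P] are
   respectively u(x + y), u(x) and u(y), x being the outer variable. *)
Definition binomial_theorem P : Prop :=
  forall n, poly_XaY (P n) =
    \sum_(i < n.+1) ((P i)^:P * (P (n - i)%N)%:P) *+ 'C(n, i).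

Definition nontrivial_seq P : Prop := exists i, P i != 0.

Definition genfun P : divseries {poly F} := DivSeries P.

Definition BDstar : set (divseries {poly F}) :=
  [set genfun P | P in [set P | binomial_theorem P /\ nontrivial_seq P]].

Lemma poly_XaY_rmorph :
  zmod_morphism (@poly_XaY F) /\ monoid_morphism (@poly_XaY F).
Proof.
rewrite /poly_XaY; split=> [u v|]; first by rewrite !raddfB.
by split=> [|u v]; rewrite ?rmorph1 ?comp_polyC ?rmorphM //= -polyC1 comp_polyC.
Qed.
HB.instance Definition _ := GRing.isZmodMorphism.Build
  {poly F} {poly {poly F}} (@poly_XaY F) poly_XaY_rmorph.1.
HB.instance Definition _ := GRing.isMonoidMorphism.Build
  {poly F} {poly {poly F}} (@poly_XaY F) poly_XaY_rmorph.2.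

Lemma binomial_theoremE P : binomial_theorem P <->
  dmap (@poly_XaY F) (genfun P) =
  dmap (map_poly polyC) (genfun P) * dmap polyC (genfun P).
Proof.
split=> [PB | PB n]; first exact: divseriesP.
exact: (congr1 (fun f : divseries _ => f n) PB).
Qed.

Lemma binomial_theorem_coef0 P :
  binomial_theorem P -> nontrivial_seq P -> P 0%N = 1.
Proof.
move=> PB [k Pk_neq0]; have := PB 0%N; rewrite big_ord1 bin0 mulr1n subnn.
have [P0|P0_neq0 PB0] := eqVneq (P 0%N) 0.
  case/eqP: Pk_neq0; elim/ltn_ind: k => k IHk.
  apply/eqP; rewrite -poly_XaY_eq0 PB big1 // => i _.
  have := ltn_ord i; rewrite ltnS leq_eqVlt => /predU1P[->|/IHk ->].
    by rewrite subnn P0 polyC0 mulr0 mul0rn.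
  by rewrite rmorph0 mul0r mul0rn.
have PX : P 0%N = (P 0%N).[0]%:P * P 0%N.
  have /(congr1 (horner^~ 0)) := PB0; rewrite horner_poly_XaY add0r comp_polyXr.
  by rewrite hornerM hornerC -polyC0 horner_map.
have P00 : (P 0%N).[0] = 1.
  by apply/polyC_inj/(mulIf P0_neq0); rewrite -PX mul1r.
have /(congr1 (horner^~ (- 'X))) := PB0.
rewrite horner_poly_XaY addNr comp_poly0r -horner_coef0 P00 hornerM hornerC.
move=> P0V; have : (P 0%N) \is a GRing.unit.
  have : (1 : {poly F}) \is a GRing.unit by exact: unitr1.
  by rewrite [1]P0V unitrM => /andP[].
rewrite poly_unitE => /andP[/size_poly1P[c _ Pc] _].
by move: P00; rewrite Pc hornerC => ->.
Qed.

Lemma BDstarE f : BDstar f <->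
  dmap (@poly_XaY F) f = dmap (map_poly polyC) f * dmap polyC f /\ f 0%N = 1.
Proof.
split=> [[P [PB PN] <-]|[fB f0]].
  by split; [apply/binomial_theoremE | apply: binomial_theorem_coef0].
exists (dcoef f); last by case: f {fB f0}.
split; last by exists 0%N; rewrite f0 oner_eq0.
by apply/binomial_theoremE; case: f fB {f0}.
Qed.

Lemma BDstar1 : BDstar 1.
Proof.
apply/BDstarE; split=> //; have dmap1 (phi : {rmorphism _ -> _}) :
    dmap phi (1 : divseries {poly F}) = 1 :> divseries {poly {poly F}}.
  by apply: divseriesP => n /=; rewrite rmorph_nat.
by rewrite !dmap1 mulr1.
Qed.

Lemma BDstarM f g : BDstar f -> BDstar g -> BDstar (f * g).
Proof.
move=> /BDstarE[fB f0] /BDstarE[gB g0]; apply/BDstarE; split.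
  by rewrite !dmapM fB gB mulrACA.
by rewrite dcoefM big_ord1 f0 g0 mul1r.
Qed.

Lemma BDstarX f n : BDstar f -> BDstar (f ^+ n).
Proof.
move=> Bf; elim: n => [|n IHn]; first exact: BDstar1.
by rewrite exprS; apply: BDstarM.
Qed.

Lemma BDstar_expp p f : p \in [pchar F] -> BDstar f -> f ^+ p = 1.
Proof.
move=> charFp /BDstarE[_ f0]; apply: divseries_expp => //.
exact: (rmorph_pchar (@polyC F)).
Qed.

End BinomialTheorem.
Arguments BDstar : clear implicits.

(* The set BDstar F as the carrier of an F_p-vector space written additively:
   + is multiplication of series, 0 is the series 1, and n%:R *: f is f ^+ n.
   The opposite is the power p - 1, as f ^+ p = 1. *)
Definition BDvect (F : fieldType) (p : nat) of p \in [pchar F] : predArgType :=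
  {f : divseries {poly F} | f \in BDstar F}.

Section BDvect.
Variables (F : fieldType) (p : nat) (charFp : p \in [pchar F]).
Local Notation V := (BDvect charFp).
Implicit Types u v w : V.

HB.instance Definition _ := SubChoice.on V.

Let p_pr : prime p := pcharf_prime charFp.

Fact bdadd_subproof u v : val u * val v \in BDstar F.
Proof. by apply/mem_set/BDstarM; apply/set_mem/valP. Qed.
Fact bdexp_subproof n u : val u ^+ n \in BDstar F.
Proof. by apply/mem_set/BDstarX/set_mem/valP. Qed.

Definition bdzero : V := Sub 1 (mem_set (@BDstar1 F)).
Definition bdadd u v : V := Sub (val u * val v) (bdadd_subproof u v).
Definition bdexp n u : V := Sub (val u ^+ n) (bdexp_subproof n u).

Lemma bdexpp u : val u ^+ p = 1.
Proof. by apply: BDstar_expp => //; apply/set_mem/valP. Qed.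

Fact bdaddA : associative bdadd.
Proof. by move=> u v w; apply: val_inj; rewrite !SubK mulrA. Qed.
Fact bdaddC : commutative bdadd.
Proof. by move=> u v; apply: val_inj; rewrite !SubK mulrC. Qed.
Fact bdadd0 : left_id bdzero bdadd.
Proof. by move=> u; apply: val_inj; rewrite !SubK mul1r. Qed.
Fact bdaddN : left_inverse bdzero (bdexp p.-1) bdadd.
Proof.
move=> u; apply: val_inj; rewrite !SubK -exprSr prednK ?prime_gt0 //.
exact: bdexpp.
Qed.

HB.instance Definition _ := GRing.isZmodule.Build V bdaddA bdaddC bdadd0 bdaddN.

Lemma bdexp_mod n u : val u ^+ (n %% (Zp_trunc (pdiv p)).+2) = val u ^+ n.
Proof. by rewrite Fp_cast // (expr_mod _ (bdexpp u)). Qed.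

Definition bdscale (c : 'F_p) u : V := bdexp c u.

Fact bdscaleA a b u : bdscale a (bdscale b u) = bdscale (a * b) u.
Proof.
apply: val_inj; by rewrite !SubK -exprM [in RHS]bdexp_mod mulnC.
Qed.
Fact bdscale1 : left_id 1 bdscale.
Proof. by move=> u; apply: val_inj; rewrite !SubK expr1. Qed.
Fact bdscaleDr : right_distributive bdscale +%R.
Proof. by move=> a u v; apply: val_inj; rewrite !SubK exprMn. Qed.
Fact bdscaleDl u : {morph bdscale^~ u : a b / a + b}.
Proof.
move=> a b; apply: val_inj.
by rewrite !SubK -exprD [in LHS]bdexp_mod.
Qed.

HB.instance Definition _ := GRing.Zmodule_isLmodule.Build 'F_p V
  bdscaleA bdscale1 bdscaleDr bdscaleDl.

Lemma val_bd0 : val (0 : V) = 1. Proof. by []. Qed.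
Lemma val_bdD u v : val (u + v) = val u * val v. Proof. by []. Qed.
Lemma val_bdZ (c : 'F_p) u : val (c *: u) = val u ^+ c. Proof. by []. Qed.

End BDvect.

Section QLinear.
Variables (q : nat) (F : fieldType).

Definition q_linear (e : {poly F}) : Prop :=
  exists (m : nat) (c : nat -> F), e = \sum_(n < m) c n *: 'X^(q ^ n).

Definition Lseq : set (nat -> {poly F}) := [set E | forall t, q_linear (E t)].

Definition digit (i t : nat) : nat := (i %/ q ^ t) %% q.

(* For q >= 2, i < q ^ i, so the digits of i at positions t >= i vanish. *)
Definition digit_prod (E : nat -> {poly F}) (i : nat) : {poly F} :=
  \prod_(t < i) E t ^+ digit i t.

Definition BDstar_q0 : set (divseries {poly F}) :=
  [set genfun (digit_prod E) | E in Lseq].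

End QLinear.
Arguments BDstar_q0 : clear implicits.
Arguments Lseq : clear implicits.

Lemma pchar_of_finsubfield (p q lambda : nat) (Fq : finFieldType)
    (F : fieldType) (iota : {rmorphism Fq -> F}) :
  prime p -> q = (p ^ lambda)%N -> #|Fq| = q -> p \in [pchar F].
Proof.
move=> p_pr -> cardFq; exact/(rmorph_pchar iota)/(card_finPcharP cardFq p_pr).
Qed.

(* Main.v *)
(** Write D_E for the series with coefficients p_{E,i}.  Since q is a power of
    the characteristic, (1 + X)^(q m + r) = (1 + X^q)^m (1 + X)^r, so binomial
    coefficients factor along base-q digits and the binomial theorem applied
    digit by digit gives D_E D_G = D_{E + G}, over any commutative ring of
    characteristic p.  Over F[x] this is closure under addition; over F[x, y]
    it is the Binomial Theorem for P_E, because each e_t is additive. *)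
From HB Require Import structures.
Require Import Defs.
From mathcomp Require Import all_boot all_algebra all_field.
From mathcomp Require Import boolp classical_sets.
Import GRing.Theory.
Local Open Scope classical_set_scope.
Local Open Scope ring_scope.

Lemma digitS (q i t : nat) : digit q i t.+1 = digit q (i %/ q) t.
Proof. by rewrite /digit expnS divnMA. Qed.

Lemma digit_small (q i t : nat) : (1 < q)%N -> (i <= t)%N -> digit q i t = 0%N.
Proof.
move=> q_gt1 le_it; rewrite /digit divn_small ?mod0n //.
exact: leq_ltn_trans le_it (ltn_expl _ q_gt1).
Qed.

Section DigitSeries.
Variables (q : nat) (R : comNzRingType).
Implicit Types E G : nat -> R.

(* [digit_prod] over an arbitrary commutative ring, so that it can also be used
   over {poly {poly F}}. *)
Definition dseries E : divseries R :=
  DivSeries (fun i => \prod_(t < i) E t ^+ digit q i t).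

Lemma dseries_coef0 E : dseries E 0%N = 1.
Proof. exact: big_ord0. Qed.

Lemma dseries_widen E i N : (1 < q)%N -> (i <= N)%N ->
  dseries E i = \prod_(t < N) E t ^+ digit q i t.
Proof.
move=> q_gt1 le_iN.
rewrite /dseries /= (big_ord_widen N (fun t => E t ^+ digit q i t) le_iN).
rewrite big_mkcond; apply: eq_bigr => t _; case: ltnP => // le_it.
by rewrite digit_small ?expr0.
Qed.

Lemma dseriesMD E m r : (1 < q)%N -> (r < q)%N ->
  dseries E (m * q + r)%N = E 0%N ^+ r * dseries (E \o succn) m.
Proof.
move=> q_gt1 lt_rq; have q_gt0 := ltnW q_gt1.
have divE : ((m * q + r) %/ q = m)%N.
  by rewrite divnMDl // divn_small // addn0.
(* One factor more than in the definition, so that position 0 can be split off even when [m * q + r]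
   is 0. *)
rewrite (@dseries_widen _ _ (m * q + r).+1) // big_ord_recl.
rewrite {1}/digit expn0 divn1 modnMDl modn_small //; congr (_ * _).
under eq_bigr => t _ do rewrite lift0 digitS divE.
rewrite [RHS](@dseries_widen _ _ (m * q + r)) //.
by rewrite (leq_trans _ (leq_addr _ _)) // leq_pmulr.
Qed.

(** Lucas's theorem in generating-function form: taking [q]-th powers is additive here, so the block
    of [m] factors [(1 + 'X) ^+ q] only produces exponents divisible by [q]. *)
Lemma exp1X_Frobenius p m r : p \in [pchar R] -> p.-nat q ->
  (1 + 'X) ^+ (m * q + r) =
    \sum_(a < m.+1) \sum_(b < r.+1)
      'X^(a * q + b) *+ ('C(m, a) * 'C(r, b)) :> {poly R}.
Proof.
move=> charRp pq.
have charPp : p \in [pchar {poly R}] by exact: (rmorph_pchar (@polyC R)).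
have q_pchar : [pchar {poly R}].-nat q.
  by rewrite (eq_pnat _ (pcharf_eq charPp)).
rewrite exprD mulnC exprM (exprDn_pchar _ _ q_pchar) expr1n !exprDn mulr_suml.
apply: eq_bigr => a _; rewrite mulr_sumr; apply: eq_bigr => b _.
rewrite !expr1n !mul1r -exprM mulrnAl mulrnAr -mulrnA.
by rewrite -exprD mulnC [('C(r, b) * _)%N]mulnC.
Qed.

(* Lets the factorization of (1 + 'X)^n act on the product f g without
   splitting the binomial coefficients themselves. *)
Lemma dcoefM_form (f g : divseries R) n :
  exists L : {additive {poly R} -> R},
    (forall i, (i <= n)%N -> L 'X^i = f i * g (n - i)%N) /\
    (f * g) n = L ((1 + 'X) ^+ n).
Proof.
pose L (u : {poly R}) := \sum_(i < n.+1) u`_i * (f i * g (n - i)%N).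
have LB : zmod_morphism L.
  by move=> u v; rewrite -sumrB; apply: eq_bigr => i _; rewrite coefB mulrBl.
pose La : {additive {poly R} -> R} :=
  HB.pack L (GRing.isZmodMorphism.Build _ _ L LB).
have LX i : (i <= n)%N -> La 'X^i = f i * g (n - i)%N.
  rewrite -ltnS => lt_in; rewrite /= /L (bigD1 (Ordinal lt_in)) //= coefXn eqxx.
  rewrite mul1r big1 ?addr0 // => j; rewrite -val_eqE /= => neq_ji.
  by rewrite coefXn (negPf neq_ji) mul0r.
exists La; split=> //; rewrite dcoefM exprDn raddf_sum; apply: eq_bigr => i _.
by rewrite expr1n mul1r raddfMn LX // -ltnS ltn_ord.
Qed.

Lemma dseriesD p E G : p \in [pchar R] -> p.-nat q -> (1 < q)%N ->
  dseries E * dseries G = dseries (fun t => E t + G t).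
Proof.
move=> charRp pq q_gt1; apply: divseriesP => n.
(* [E] and [G] must vary: passing from [n] to [n %/ q] shifts both sequences. *)
elim/ltn_ind: n => n IHn in E G *.
have [->|n_gt0] := posnP n.
  by rewrite dcoefM big_ord1 !dseries_coef0 mul1r.
set m := (n %/ q)%N; set r := (n %% q)%N.
have lt_rq : (r < q)%N by rewrite ltn_mod ltnW.
have nE : n = (m * q + r)%N by exact: divn_eq.
have lt_mn : (m < n)%N by rewrite ltn_Pdiv.
have [L [LX ->]] := dcoefM_form (dseries E) (dseries G) n.
have LXn k i (le_in : (i <= n)%N) :
    L ('X^i *+ k) = (dseries E i * dseries G (n - i)%N) *+ k.
  by rewrite raddfMn LX.
(* On the right the lowest digit is split off and the induction hypothesis turns the rest into a
   product; on the left [L] meets the factored power. *)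
rewrite [in RHS]nE dseriesMD // -(IHn m) // [in LHS]nE (exp1X_Frobenius p) //.
(* After the swap, [exprDn] puts the exponent [b] on [E 0] and [r - b] on [G 0]. *)
rewrite dcoefM [E _ + _]addrC exprDn raddf_sum mulr_sumr; apply: eq_bigr => a _.
rewrite raddf_sum mulr_suml; apply: eq_bigr => b _.
have le_am : (a <= m)%N by rewrite -ltnS.
have le_br : (b <= r)%N by rewrite -ltnS.
(* No borrow occurs, so [r - b] is the lowest digit of the complementary index and [dseriesMD]
   applies to both factors. *)
have nB : (n - (a * q + b) = (m - a) * q + (r - b))%N.
  by rewrite nE mulnBl addnBA // addnBAC ?leq_mul // subnDA.
rewrite LXn ?nB; last by rewrite nE leq_add ?leq_mul.
have lt_bq := leq_ltn_trans le_br lt_rq.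
have lt_rbq := leq_ltn_trans (leq_subr b r) lt_rq.
rewrite !dseriesMD //.
rewrite mulrnAl mulrnAr -mulrnA; congr (_ *+ _).
by rewrite mulrACA [E 0%N ^+ _ * _]mulrC.
Qed.

(* D_0 is idempotent and D_0^p = 1. *)
Lemma dseries_cst0 p : p \in [pchar R] -> p.-nat q -> (1 < q)%N ->
  dseries (fun=> 0) = 1.
Proof.
move=> charRp pq q_gt1; set D := dseries _.
have DD : D * D = D.
  by rewrite (dseriesD p) //; congr dseries; apply: funext => t; rewrite addr0.
have DX k : D ^+ k.+1 = D by elim: k => // k IHk; rewrite exprS IHk.
have := divseries_expp charRp (dseries_coef0 (fun=> 0)).
by rewrite -(prednK (prime_gt0 (pcharf_prime charRp))) DX.
Qed.

End DigitSeries.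

Arguments dseries q [R] E.

(** Used for the three substitutions of x + y, x and y, which turns the Binomial Theorem into an
    instance of [dseriesD]. *)
Lemma dmap_dseries q (R S : comNzRingType) (phi : {rmorphism R -> S}) E :
  dmap phi (dseries q E) = dseries q (phi \o E).
Proof.
apply: divseriesP => i; rewrite /dseries /= rmorph_prod.
by apply: eq_bigr => t _; rewrite rmorphXn.
Qed.

Section QLinearClosure.
Variables (p q : nat) (F : fieldType).
Hypotheses (charFp : p \in [pchar F]) (pq : p.-nat q) (q_gt1 : (1 < q)%N).

Let charPp : p \in [pchar {poly F}].
Proof. exact: (rmorph_pchar (@polyC F)). Qed.

Lemma q_linear0 : q_linear q (0 : {poly F}).
Proof. by exists 0%N, (fun=> 0); rewrite big_ord0. Qed.

Lemma q_linearD (e g : {poly F}) :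
  q_linear q e -> q_linear q g -> q_linear q (e + g).
Proof.
have widen (m N : nat) (c : nat -> F) : (m <= N)%N ->
    \sum_(n < m) c n *: 'X^(q ^ n) =
    \sum_(n < N) (if (n < m)%N then c n else 0) *: 'X^(q ^ n) :> {poly F}.
  move=> le_mN; rewrite (big_ord_widen N (fun n => c n *: 'X^(q ^ n)) le_mN).
  by rewrite big_mkcond; apply: eq_bigr => n _; case: ifP; rewrite ?scale0r.
move=> [m [c ->]] [k [d ->]]; exists (maxn m k).
exists (fun n =>
  (if (n < m)%N then c n else 0) + (if (n < k)%N then d n else 0)).
rewrite (widen _ _ _ (leq_maxl m k)) (widen _ _ _ (leq_maxr m k)) -big_split.
by apply: eq_bigr => n _; rewrite scalerDl.
Qed.

(** Each monomial has exponent a power of [q], hence of the characteristic, so Frobenius splits the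
    power of x + y. *)
Lemma poly_XaY_q_linear (e : {poly F}) : q_linear q e ->
  poly_XaY e = e^:P + e%:P.
Proof.
have charPPp : p \in [pchar {poly {poly F}}].
  exact: (rmorph_pchar (@polyC {poly F})).
move=> [m [c ->]]; rewrite !rmorph_sum -big_split; apply: eq_bigr => n _ /=.
have q_pchar : [pchar {poly {poly F}}].-nat (q ^ n)%N.
  by rewrite (eq_pnat _ (pcharf_eq charPPp)) pnatX pq.
rewrite -!mul_polyC !rmorphM !rmorphXn /=.
rewrite /poly_XaY !map_polyC !map_polyX comp_polyC comp_polyX.
by rewrite (exprDn_pchar _ _ q_pchar) mulrDr.
Qed.

Lemma BDstar_q0_sub : BDstar_q0 q F `<=` BDstar F.
Proof.
move=> _ [E LE <-]; apply/BDstarE; split; last exact: dseries_coef0.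
(* [digit_prod] and the coefficients of [dseries] agree by conversion. *)
rewrite -[genfun _]/(dseries q E) !dmap_dseries (dseriesD _ _ p) //; last first.
  exact: (rmorph_pchar (@polyC {poly F})).
congr dseries; apply: funext => t; exact: poly_XaY_q_linear.
Qed.

Lemma BDstar_q0_1 : BDstar_q0 q F 1.
Proof.
by exists (fun=> 0); [move=> t; apply: q_linear0 | apply: (dseries_cst0 _ _ p)].
Qed.

Lemma BDstar_q0M f g :
  BDstar_q0 q F f -> BDstar_q0 q F g -> BDstar_q0 q F (f * g).
Proof.
move=> [E LE <-] [G LG <-]; exists (fun t => E t + G t).
  by move=> t; apply: q_linearD.
exact/esym/(dseriesD _ _ p).
Qed.

Lemma BDstar_q0X f k : BDstar_q0 q F f -> BDstar_q0 q F (f ^+ k).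
Proof.
move=> Bf; elim: k => [|k IHk]; first exact: BDstar_q0_1.
by rewrite exprS; apply: BDstar_q0M.
Qed.

End QLinearClosure.

Theorem corollary2 (p q lambda : nat) (hp : prime p) (hlambda : (1 <= lambda)%N)
    (hq : q = (p ^ lambda)%N) (F : fieldType) (Fq : finFieldType)
    (hFq : #|Fq| = q) (iota : {rmorphism Fq -> F}) :
  (BDstar_q0 q F `<=` BDstar F) /\
  GRing.submod_closed
    [pred v : BDvect (pchar_of_finsubfield iota hp hq hFq)
       | val v \in BDstar_q0 q F].
Proof.
have charFp := pchar_of_finsubfield iota hp hq hFq.
have pq : p.-nat q by rewrite hq pnatX pnat_id.
have q_gt1 : (1 < q)%N by rewrite hq -(expn0 p) ltn_exp2l ?prime_gt1.
split; first exact: (BDstar_q0_sub p).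
(* Multiplicatively, it remains to find 1 and [val u ^+ c * val v] in the set. *)
split=> [|c u v]; rewrite !inE.
  exact: (BDstar_q0_1 p).
move=> Bu Bv; rewrite val_bdD val_bdZ.
by apply: (BDstar_q0M p) => //; apply: (BDstar_q0X p).
Qed.
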